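(* Let $\mathbf P\in\mathcal P$, $\mathbf Q\in\mathcal Q$, $\mathbf R\in\mathcal R$ with $\lambda_{\mathbf{PQ}}\lambda_{\mathbf{QR}}\neq 0$. Then the expected mean square for $(\mathbf P\vartriangleright\mathbf Q)\vartriangleright\mathbf R$ is $$\xi_{\mathbf P}+r\lambda_{\mathbf{PQ}}\eta_{\mathbf Q}+\frac{\lambda_{\mathbf{PQ}}\lambda_{\mathbf{QR}}\,\boldsymbol\tau'\mathbf X_h'\mathbf X_f'\mathbf R\mathbf X_f\mathbf X_h\boldsymbol\tau}{\operatorname{rank}(\mathbf R)}.$$
   Context: Setting (chain of two randomizations). $\Omega,\Upsilon,\Gamma$ are finite sets, $f\colon\Omega\to\Upsilon$ and $h\colon\Upsilon\to\Gamma$ are surjective maps, and $f$ is equireplicate: every element of $\Upsilon$ has exactly $r$ preimages. $\mathbf X_f$ is the $\Omega\times\Upsilon$ matrix with $(\omega,\upsilon)$-entry $1$ if $f(\omega)=\upsilon$ and $0$ otherwise; $\mathbf X_h$ is the analogous $\Upsilon\times\Gamma$ matrix; $\mathbf D_h=\mathbf X_h'\mathbf X_h$. Primes denote transposes. A transitive permutation group $G$ on a finite set $S$ is stratifiable if the symmetric $0$-$1$ matrices of its symmetrized orbits on $S\times S$ all commute; the orthogonal projectors onto their common eigenspaces (strata) are its stratum projectors. $\mathcal P$ is the set of stratum projectors ($\Omega\times\Omega$ nonzero symmetric, mutually orthogonal idempotents summing to $\mathbf I_\Omega$) of a transitive stratifiable group $G_1$ on $\Omega$. $\mathcal Q$ arises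 from the stratum projectors $\mathbf Q_\Upsilon$ ($\Upsilon\times\Upsilon$, summing to $\mathbf I_\Upsilon$) of a transitive stratifiable group $G_2$ on $\Upsilon$ (or from a refinement in which some of these are replaced by mutually orthogonal nonzero symmetric sub-idempotents summing to them, all pieces keeping the same coefficient $\eta$): each $\mathbf Q_\Upsilon$ is replaced by the $\Omega\times\Omega$ matrix $\mathbf Q=r^{-1}\mathbf X_f\mathbf Q_\Upsilon\mathbf X_f'$. These are mutually orthogonal symmetric idempotents with sum $\mathbf I_{\mathcal Q}=r^{-1}\mathbf X_f\mathbf X_f'$. $\mathcal R$ arises from a set of nonzero symmetric, mutually orthogonal $\Upsilon\times\Upsilon$ idempotents $\mathbf R_\Upsilon$ with sum $\mathbf X_h\mathbf D_h^{-1}\mathbf X_h'$, each replaced by $\mathbf R=r^{-1}\mathbf X_f\mathbf R_\Upsilon\mathbf X_f'$; put $\mathbf I_{\mathcal R}=\sum_{\mathbf R\in\mathcal R}\mathbf R$. Model. $\mathbf Y=\mathbf Z+\mathbf X_f\mathbf W+\mathbf X_f\mathbf X_h\boldsymbol\tau$, where $\boldsymbol\tau\in\mathbb R^\Gamma$ is a fixed vector, $\mathbf Z$ (indexed by $\Omega$) and $\mathbf W$ (indexed by $\Upsilon$) are independent random vectors with mean zero, $\operatorname{Cov}(\mathbf Z)=\sum_{\mathbf P}\xi_{\mathbf P}\mathbf P$ and $\operatorname{Cov}(\mathbf W)=\sum\eta_{\mathbf Q}\mathbf Q_\Upsilon$ with $\xi_{\mathbf P},\eta_{\mathbf Q}\ge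 0$. Thus $\operatorname E(\mathbf Y)=\mathbf X_f\mathbf X_h\boldsymbol\tau$ and $\operatorname{Cov}(\mathbf Y)=\mathbf V=\sum_{\mathbf P\in\mathcal P}\xi_{\mathbf P}\mathbf P+r\sum_{\mathbf Q\in\mathcal Q}\eta_{\mathbf Q}\mathbf Q$. Structure balance (assumed). $\mathcal Q$ is structure balanced in relation to $\mathcal P$: there are scalars $\lambda_{\mathbf{PQ}}$ with $\mathbf Q\mathbf P\mathbf I_{\mathcal Q}=\lambda_{\mathbf{PQ}}\mathbf Q$ for all $\mathbf P\in\mathcal P$, $\mathbf Q\in\mathcal Q$. $\mathcal R$ is structure balanced in relation to $\mathcal Q$: there are scalars $\lambda_{\mathbf{QR}}$ with $\mathbf R\mathbf Q\mathbf I_{\mathcal R}=\lambda_{\mathbf{QR}}\mathbf R$ for all $\mathbf Q\in\mathcal Q$, $\mathbf R\in\mathcal R$. Derived idempotents. If $\lambda_{\mathbf{PQ}}\ne0$, $\mathbf P\vartriangleright\mathbf Q=\lambda_{\mathbf{PQ}}^{-1}\mathbf{PQP}$. If also $\lambda_{\mathbf{QR}}\ne0$, $(\mathbf P\vartriangleright\mathbf Q)\vartriangleright\mathbf R=\lambda_{\mathbf{PQ}}^{-1}\lambda_{\mathbf{QR}}^{-1}\mathbf{PQRQP}$. The mean square for a nonzero symmetric idempotent $\mathbf A$ is $\mathbf Y'\mathbf A\mathbf Y/\operatorname{rank}(\mathbf A)$, and the expected mean square is its expectation. *)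

(* Defs.v *)
From HB Require Import structures.
From mathcomp Require Import all_boot all_order all_algebra all_fingroup.
From mathcomp Require Import all_classical all_reals all_analysis.

Set Implicit Arguments.
Unset Strict Implicit.
Unset Printing Implicit Defensive.

Import Order.TTheory GRing.Theory Num.Theory.

Local Open Scope ring_scope.

(* A vector or matrix indexed by a finite set S has index type 'I_#|S|; the
   index i stands for the element enum_val i of S. *)

Section PermutationGroups.
Variables (R : realType) (S : finType).

(* The symmetrized orbit of the pair (a, b) is the union of the G-orbits of
   (a, b) and (b, a) on S * S. *)
Definition sym_orbit (G : {group {perm S}}) (a b : S) : rel S :=
  fun x y => [exists g in G, ((g a, g b) == (x, y)) || ((g a, g b) == (y, x))].

Definition sym_orbit_mx (G : {group {perm S}}) (a b : S) : 'M[R]_#|S| :=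
  \matrix_(i, j) (sym_orbit G a b (enum_val i) (enum_val j))%:R.

Definition stratifiable (G : {group {perm S}}) : Prop :=
  [transitive G, on [set: S] | 'P] /\
  forall a b c d : S, comm_mx (sym_orbit_mx G a b) (sym_orbit_mx G c d).

(* The row space of this matrix is the set of vectors that are eigenvectors of
   every sym_orbit_mx G a b, with eigenvalue theta (a, b).  These matrices are
   symmetric, so row and column eigenvectors agree. *)
Definition common_eigenspace (G : {group {perm S}}) (theta : S * S -> R) :
    'M[R]_#|S| :=
  (\bigcap_(p : S * S) eigenspace (sym_orbit_mx G p.1 p.2) (theta p))%MS.

Definition orthogonal_projector n (E U : 'M[R]_n) : Prop :=
  [/\ E^T = E, E *m E = E & (E == U)%MS].

Definition is_stratum_projector (G : {group {perm S}}) (E : 'M[R]_#|S|) :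
    Prop :=
  exists theta : S * S -> R, common_eigenspace G theta != 0 /\
    orthogonal_projector E (common_eigenspace G theta).

(* E enumerates, without repetition, all the stratum projectors of G. *)
Definition stratum_projectors (G : {group {perm S}}) (I : finType)
    (E : I -> 'M[R]_#|S|) : Prop :=
  injective E /\
  forall A : 'M[R]_#|S|, is_stratum_projector G A <-> exists i, A = E i.

End PermutationGroups.

Section Idempotents.
Variables (R : realType) (n : nat).

Definition orthogonal_idempotents (I : finType) (E : I -> 'M[R]_n) : Prop :=
  [/\ forall i, E i != 0, forall i, (E i)^T = E i,
      forall i, E i *m E i = E i &
      forall i j, i != j -> E i *m E j = 0].

(* Each S k is split into the pieces E j with s j = k; the family S itself is
   the case s = id. *)
Definition refinement (K J : finType) (S : K -> 'M[R]_n) (s : J -> K)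
    (E : J -> 'M[R]_n) : Prop :=
  orthogonal_idempotents E /\ forall k, S k = \sum_(j | s j == k) E j.

Definition structure_balanced (I J : finType) (P : I -> 'M[R]_n)
    (Q : J -> 'M[R]_n) (lam : I -> J -> R) : Prop :=
  forall i j, Q j *m P i *m (\sum_j' Q j') = lam i j *: Q j.

(* (P |> Q) |> R', where lPQ and lQR are the nonzero balance coefficients. *)
Definition derived_idempotent (lPQ lQR : R) (P Q R' : 'M[R]_n) : 'M[R]_n :=
  (lPQ^-1 * lQR^-1) *: (P *m Q *m R' *m Q *m P).

End Idempotents.

Definition incidence (R : realType) (A B : finType) (f : A -> B) :
    'M[R]_(#|A|, #|B|) :=
  \matrix_(i, j) (f (enum_val i) == enum_val j)%:R.

Arguments incidence R {A B} f.

Definition equireplicate (A B : finType) (f : A -> B) (r : nat) : Prop :=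
  forall b : B, #|[pred a | f a == b]| = r.

Section Probability.
Context d (T : measurableType d) (R : realType) (Pr : probability T R).

(* Independence of two random vectors: independence of the sigma-algebras
   generated by their coordinates. *)
Definition independent_vectors m n (Z : 'I_m -> {RV Pr >-> R})
    (W : 'I_n -> {RV Pr >-> R}) : Prop :=
  forall A B : set T,
    g_sigma_preimage (fun i => Z i : T -> R) A ->
    g_sigma_preimage (fun j => W j : T -> R) B ->
    Pr (A `&` B)%classic = (Pr A * Pr B)%E.

(* Square integrability is what makes the covariance matrix meaningful. *)
Definition mean0_cov n (Z : 'I_n -> {RV Pr >-> R}) (V : 'M[R]_n) : Prop :=
  [/\ forall i, (Z i : T -> R) \in Lfun Pr 2%:E,
      forall i, 'E_Pr[Z i]%E = 0%E &
      forall i j, covariance Pr (Z i) (Z j) = (V i j)%:E].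

Definition mean_square n (Y : T -> 'cV[R]_n) (A : 'M[R]_n) (t : T) : R :=
  ((Y t)^T *m A *m Y t) 0 0 / (\rank A)%:R.

Definition expected_mean_square n (Y : T -> 'cV[R]_n) (A : 'M[R]_n) : \bar R :=
  'E_Pr[mean_square Y A]%E.

End Probability.

(* Main.v *)
Require Import Defs.
From HB Require Import structures.
From mathcomp Require Import all_boot all_order all_algebra all_fingroup.
From mathcomp Require Import all_classical all_reals all_analysis.
From mathcomp Require Import measurable_realfun complex ring.

Set Implicit Arguments.
Unset Strict Implicit.
Unset Printing Implicit Defensive.

Import Order.TTheory GRing.Theory Num.Theory.

Local Open Scope ring_scope.

(* For a random vector, E(Y'AY) = tr(A Cov(Y)) + E(Y)' A E(Y), so everything
   reduces to matrix algebra with A = (P |> Q) |> R.  Structure balance says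
   Q P Q1 = lambda_PQ Q or 0 according as Q1 = Q or not, and similarly for R
   and Q.  Hence A is idempotent, A P1 and A Q1 vanish unless P1 = P and
   Q1 = Q respectively, and the traces of A and A Q are multiples of
   tr(R) = rank(R).  The mean E(Y) is fixed by I_R, and also by I_Q, because
   the strata of a stratifiable group span the whole space: real symmetric
   commuting matrices are simultaneously diagonalizable. *)

(** * Simultaneous diagonalization and orthogonal projectors *)

(** Each diagonal entry of [v *m v^T] is the sum of the squares of a row of [v]. *)
Lemma mul_tr_eq0 (R : realDomainType) m n (v : 'M[R]_(m, n)) :
  v *m v^T = 0 -> v = 0.
Proof.
move=> vv; apply/matrixP => i j; rewrite mxE.
have /matrixP/(_ i i) := vv; rewrite !mxE => /eqP.
rewrite psumr_eq0 => [|k _]; last by rewrite mxE -expr2 sqr_ge0.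
by move=> /allP/(_ j (mem_index_enum _)); rewrite mxE mulf_eq0 orbb => /eqP.
Qed.

(** Over the complex numbers [A] is Hermitian, hence unitarily diagonalizable with real eigenvalues.
    The product of the distinct real factors X - e therefore annihilates [A] after extension of
    scalars, and so already over [R], which makes [A] diagonalizable there. *)
Lemma trmx_diagonalizable (R : rcfType) n (A : 'M[R]_n) :
  A^T = A -> diagonalizable A.
Proof.
case: n A => [|n] A symA.
  by exists 1%:M; rewrite ?unitmx1//; apply/is_diag_mxP => -[].
pose C : numClosedFieldType := complex.complex R.
pose iota : {rmorphism R -> C} := @complex.real_complex_def R (Phant R).
pose AC : 'M[C]_n.+1 := map_mx iota A.
have AC_herm : AC \is hermsymmx.
  apply: realsym_hermsym.
    apply/is_hermitianmxP; rewrite expr0 scale1r.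
    by apply/matrixP => i j; rewrite !mxE/= -[in LHS]symA mxE.
  apply/mxOverP => i j; rewrite mxE.
  by apply/complex.complex_realP; exists (A i j).
have /hermitian_normalmx/orthomx_spectralP ACE := AC_herm.
have /mxOverP dR := hermitian_spectral_diag_real AC_herm.
set M := spectralmx AC in ACE; set d := spectral_diag AC in ACE dR.
have uM : M \in unitmx := spectral_unit AC.
pose e k := complex.Re (d 0 k).
have eE k : iota (e k) = d 0 k by exact/complex.RRe_real/dR.
(* The criterion asks for pairwise distinct roots, so repeated eigenvalues are merged by [undup]. *)
apply/diagonalizableP; exists (undup [seq e k | k <- enum 'I_n.+1]).
  exact: undup_uniq.
apply: mxminpoly_min; apply: (map_mx_inj (f := iota)).
rewrite map_mx0 map_horner_mx -/AC ACE.
rewrite horner_mx_uconjC; last exact: uM.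
rewrite horner_mx_diag [X in diag_mx X](_ : _ = 0).
  by rewrite linear0 mulmx0 mul0mx.
apply/rowP => k; rewrite !mxE -eE horner_map; apply/eqP.
rewrite fmorph_eq0 -/(root _ _) root_prod_XsubC mem_undup.
by apply/mapP; exists k; rewrite ?mem_enum.
Qed.

(** The rows of [M] are a basis of joint eigenvectors, each with its own family of eigenvalues. *)
Lemma trmx_codiagonalizable (R : rcfType) n (I : finType) (A : I -> 'M[R]_n) :
    (forall i, (A i)^T = A i) -> (forall i j, comm_mx (A i) (A j)) ->
  exists2 M : 'M[R]_n, M \in unitmx &
    forall k, exists theta : I -> R,
      forall i, (row k M <= eigenspace (A i) (theta i))%MS.
Proof.
move=> symA comA.
have [|M uM /allP MA] := (codiagonalizableP [seq A i | i : I]).1.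
  split=> [_ _ /codomP[i ->] /codomP[j ->]|_ /codomP[i ->]] //.
  exact: trmx_diagonalizable.
exists M => // k.
have MAE i : exists D, M *m A i = diag_mx D *m M.
  have /MA/(diagonalizable_forLR uM)[D ->] : A i \in [seq A i | i : I].
    exact: codom_f.
  by exists D; rewrite mxpoly.conjVmx// !mulmxA mulmxV// mul1mx.
(* The eigenvalue of [A i] on row [k] is the [k]-th diagonal entry of the matrix with which [M]
   conjugates [A i]. *)
exists (fun i => (sval (cid (MAE i))) 0 k) => i; case: cid => D /= MAi.
by apply/eigenspaceP; rewrite -row_mul MAi row_mul row_diag_mx -scalemxAl -rowE.
Qed.

(** If N B B' = 0 then (N B)(N B)' = 0, so N B = 0, and N = 0 because [B] has independent rows. *)
Lemma row_free_mul_tr_unit (R : realFieldType) m n (B : 'M[R]_(m, n)) :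
  row_free B -> B *m B^T \in unitmx.
Proof.
move=> freeB; rewrite -row_free_unit -kermx_eq0; apply/eqP.
set N := kermx _; apply/eqP; rewrite -(mulmx_free_eq0 _ freeB); apply/eqP.
apply: mul_tr_eq0.
by rewrite trmx_mul mulmxA -[N *m B *m _]mulmxA mulmx_ker mul0mx.
Qed.

Section OrthogonalProjectors.
Variables (R : realType) (n : nat).
Implicit Types E U : 'M[R]_n.

Lemma orthogonal_projector_exists U : exists E, orthogonal_projector E U.
Proof.
have [B freeB UB] : exists2 B : 'M[R]_(\rank U, n), row_free B & (U :=: B)%MS.
  by exists (row_base U); [exact: row_base_free|exact/eqmx_sym/eq_row_base].
have uBB := row_free_mul_tr_unit freeB.
(* The Gram formula for the orthogonal projector onto the span of the rows of [B]. *)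
exists (B^T *m invmx (B *m B^T) *m B); split.
- by rewrite !trmx_mul trmxK trmx_inv trmx_mul trmxK mulmxA.
- by rewrite !mulmxA -[_ *m B *m B^T]mulmxA mulmxKV.
apply/andP; split; first by rewrite UB submxMl.
rewrite UB; apply/submxP; exists B.
by rewrite !mulmxA mulmxV// mul1mx.
Qed.

(** Equal row spaces give E F = E and F E = F; transposing the first yields F E = E. *)
Lemma orthogonal_projector_inj U E F :
  orthogonal_projector E U -> orthogonal_projector F U -> E = F.
Proof.
have abs E' F' : orthogonal_projector E' U -> orthogonal_projector F' U ->
    E' *m F' = E'.
  move=> [_ _ /andP[EU _]] [_ FF /andP[_ UF]].
  by have /submxP[X ->] := submx_trans EU UF; rewrite -mulmxA FF.
move=> pE pF; have [[sE _ _] [sF _ _]] := (pE, pF).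
by have := congr1 trmx (abs _ _ pE pF); rewrite trmx_mul sE sF (abs _ _ pF pE).
Qed.

End OrthogonalProjectors.

(** * Strata of a stratifiable group *)

Section Strata.
Variables (R : realType) (S : finType) (G : {group {perm S}}).

Lemma trmx_sym_orbit_mx (a b : S) :
  (sym_orbit_mx R G a b)^T = sym_orbit_mx R G a b.
Proof.
apply/matrixP => i j; rewrite !mxE; congr (nat_of_bool _)%:R.
by apply: eq_existsb => g; rewrite orbC.
Qed.

Lemma is_stratum_projectorP (E : 'M[R]_#|S|) : is_stratum_projector G E ->
  [/\ E^T = E, E *m E = E & exists theta : S * S -> R,
    orthogonal_projector E (common_eigenspace G theta) /\
    forall p, E *m sym_orbit_mx R G p.1 p.2 = theta p *: E].
Proof.
move=> [theta [_ pE]]; have [sE EE /andP[EU _]] := pE; split=> //.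
exists theta; split=> // p; apply/eigenspaceP/(submx_trans EU).
exact: bigcapmx_inf.
Qed.

(** Eigenvectors of a symmetric matrix for different eigenvalues are orthogonal. Hence E F nonzero
    forces the two eigenvalue families to agree, and then both matrices project onto the same
    space. *)
Lemma stratum_projector_orthogonal (E F : 'M[R]_#|S|) :
    is_stratum_projector G E -> is_stratum_projector G F -> E != F ->
  E *m F = 0.
Proof.
move=> /is_stratum_projectorP[sE EE [thE [pE EA]]].
move=> /is_stratum_projectorP[sF FF [thF [pF FA]]].
apply: contra_neqP => /eqP EF0; have -> : E = F; last by [].
apply: (orthogonal_projector_inj pE); suff -> : thE = thF by [].
apply/funext => p; apply/eqP; rewrite -subr_eq0; apply: contraT => th_neq.
have := congr1 (mulmx^~ F) (EA p); rewrite -scalemxAl.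
have -> : E *m sym_orbit_mx R G p.1 p.2 *m F = thF p *: (E *m F).
  have /(congr1 trmx) := FA p.
  rewrite trmx_mul trmx_sym_orbit_mx linearZ /= sF -mulmxA => ->.
  by rewrite scalemxAr.
move/eqP; rewrite eq_sym -subr_eq0 -scalerBl scaler_eq0 (negPf th_neq) /=.
by move=> EF0'; rewrite EF0' in EF0.
Qed.

Variables (I : finType) (E : I -> 'M[R]_#|S|).
Hypothesis E_strata : stratum_projectors G E.

Let E_strat i : is_stratum_projector G (E i).
Proof. by apply/E_strata.2; exists i. Qed.

Lemma stratum_projectors_tr i : (E i)^T = E i.
Proof. by have /is_stratum_projectorP[] := E_strat i. Qed.

Lemma stratum_projectors_idem i j : E i *m E j = (i == j)%:R *: E i.
Proof.
have [<-|neq] := eqVneq i j.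
  by rewrite scale1r; have /is_stratum_projectorP[] := E_strat i.
rewrite scale0r; apply: stratum_projector_orthogonal => //.
by apply: contra_neq neq; exact: E_strata.1.
Qed.

(** It is enough that the sum fixes every row of an invertible matrix of joint eigenvectors. Such a
    row lies in some common eigenspace, whose projector fixes it while all the others kill it. *)
Lemma sum_stratum_projectors : stratifiable R G -> \sum_i E i = 1%:M.
Proof.
move=> [_ Gcom].
have [M uM MA] := @trmx_codiagonalizable R #|S| _
  (fun p : S * S => sym_orbit_mx R G p.1 p.2)
  (fun p => trmx_sym_orbit_mx p.1 p.2) (fun p q => Gcom _ _ _ _).
suff ME : M *m \sum_i E i = M.
  by rewrite -[LHS](mulKmx uM) ME mulVmx.
apply/row_matrixP => k; rewrite row_mul.
have [theta Mk] := MA k.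
have MkU : (row k M <= common_eigenspace G theta)%MS by exact/sub_bigcapmxP.
have [F pF] := orthogonal_projector_exists (common_eigenspace G theta).
have [i FE] : exists i, F = E i.
  apply/E_strata.2; exists theta; split=> //.
  (* The eigenspace is nonzero because it contains a row of an invertible matrix. *)
  apply/eqP => U0; move: MkU; rewrite U0 submx0 => /eqP.
  move/(congr1 (mulmx^~ (invmx M))); rewrite -row_mul mulmxV// mul0mx.
  by move=> /rowP/(_ k)/eqP; rewrite !mxE eqxx oner_eq0.
have /submxP[X ->] : (row k M <= E i)%MS.
  by apply: (submx_trans MkU); have [_ _ /andP[]] := pF; rewrite FE.
rewrite -mulmxA mulmx_sumr (bigD1 i)//= big1 ?addr0 => [|j].
  by rewrite stratum_projectors_idem eqxx scale1r.
by rewrite stratum_projectors_idem eq_sym => /negPf ->; rewrite scale0r.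
Qed.

End Strata.

(** * Structure balance *)

Section BalancedAlgebra.
Variables (R : realType) (n : nat).
Implicit Types A P Q S : 'M[R]_n.

(** In a full rank factorization A = c r, idempotence forces r c = 1, an identity matrix of size
    [\rank A]; and tr(c r) = tr(r c). *)
Lemma mxtrace_idem A : A *m A = A -> \tr A = (\rank A)%:R.
Proof.
suff rc1 k (c : 'M[R]_(n, k)) (r : 'M[R]_(k, n)) :
    row_full c -> row_free r -> c *m r *m (c *m r) = c *m r -> r *m c = 1%:M.
  move=> AA; rewrite -{1}(mulmx_base A) mxtrace_mulC rc1 ?mxtrace1//.
  - exact: col_base_full.
  - exact: row_base_free.
  - by rewrite mulmx_base.
move=> /row_fullP[D Dc] /row_freeP[C rC] /(congr1 (fun M => D *m M *m C)).
by rewrite -!mulmxA rC !mulmx1 !mulmxA Dc !mul1mx.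
Qed.

Variables (P Q S : 'M[R]_n) (a b : R).
Hypotheses (PP : P *m P = P) (QPQ : Q *m P *m Q = a *: Q).
Hypotheses (SS : S *m S = S) (SQS : S *m Q *m S = b *: S).
Hypotheses (a0 : a != 0) (b0 : b != 0).

Let A := derived_idempotent a b P Q S.

Lemma derived_mulP : A *m P = A.
Proof. by rewrite /A /derived_idempotent -scalemxAl -mulmxA PP. Qed.

Lemma trace_mul_idem : \tr (Q *m S) = b * \tr S.
Proof.
by rewrite -{1}SS mulmxA mxtrace_mulC mulmxA SQS mxtraceZ.
Qed.

(** In the square, the inner Q P P Q collapses to a Q and then S Q S to b S, which cancels one of
    the two normalizing factors. Here [S] stands for a member of the third family. *)
Lemma derived_idem : A *m A = A.
Proof.
rewrite /A /derived_idempotent -scalemxAl -scalemxAr scalerA.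
have -> : P *m Q *m S *m Q *m P *m (P *m Q *m S *m Q *m P) =
    (a * b) *: (P *m Q *m S *m Q *m P).
  have -> : P *m Q *m S *m Q *m P *m (P *m Q *m S *m Q *m P) =
     P *m Q *m S *m (Q *m (P *m P) *m Q) *m S *m Q *m P by rewrite !mulmxA.
  rewrite PP QPQ -scalemxAr -!scalemxAl -scalerA; congr (_ *: _).
  have -> : P *m Q *m S *m Q *m S *m Q *m P =
    P *m Q *m (S *m Q *m S) *m Q *m P by rewrite !mulmxA.
  by rewrite SQS -scalemxAr -!scalemxAl.
by rewrite scalerA; congr (_ *: _); rewrite -[RHS]mulr1; field; rewrite ?a0 ?b0.
Qed.

Lemma mxtrace_derivedM B : \tr (A *m B) =
  a^-1 * b^-1 * \tr (P *m (Q *m S *m (Q *m P *m B))).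
Proof. by rewrite /A /derived_idempotent -scalemxAl mxtraceZ !mulmxA. Qed.

(** Up to cyclic permutation, Q P Q occurs twice and contributes a^2, while tr(Q S) contributes b;
    dividing by a b leaves a. This is the coefficient that accompanies eta. *)
Lemma mxtrace_derivedQ : \tr (A *m Q) = a * \tr S.
Proof.
rewrite mxtrace_derivedM QPQ mxtrace_mulC.
rewrite -!scalemxAr -!scalemxAl mxtraceZ -!mulmxA mxtrace_mulC -!mulmxA.
rewrite [Q *m (P *m Q)]mulmxA QPQ.
rewrite -scalemxAr mxtraceZ mxtrace_mulC trace_mul_idem.
by field; rewrite ?a0 ?b0.
Qed.

(** By cyclicity the outer factors P merge, so Q P Q occurs only once and the normalization cancels
    entirely. With [mxtrace_idem] this makes the ranks equal. *)
Lemma mxtrace_derived : \tr A = \tr S.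
Proof.
rewrite -derived_mulP mxtrace_derivedM.
rewrite mxtrace_mulC -!mulmxA PP PP.
have -> : Q *m (S *m (Q *m P)) = Q *m S *m (Q *m P) by rewrite !mulmxA.
rewrite mxtrace_mulC mulmxA QPQ -scalemxAl mxtraceZ trace_mul_idem.
by field; rewrite ?a0 ?b0.
Qed.

(** Each side of the form absorbs P with a factor a and Q with a factor b; the resulting (a b)^2 is
    divided by a b. *)
Lemma derived_quadratic_form (mu : 'cV[R]_n) :
    P^T = P -> Q^T = Q -> S^T = S ->
    Q *m P *m mu = a *: (Q *m mu) -> S *m Q *m mu = b *: (S *m mu) ->
  mu^T *m A *m mu = (a * b) *: (mu^T *m S *m mu).
Proof.
move=> sP sQ sS QPmu SQmu; rewrite /A /derived_idempotent.
have muPQ : mu^T *m P *m Q = a *: (mu^T *m Q).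
  by have := congr1 trmx QPmu; rewrite linearZ /= !trmx_mul sP sQ mulmxA.
have muQS : mu^T *m Q *m S = b *: (mu^T *m S).
  by have := congr1 trmx SQmu; rewrite linearZ /= !trmx_mul sS sQ mulmxA.
rewrite -scalemxAr -scalemxAl.
have -> : mu^T *m (P *m Q *m S *m Q *m P) *m mu =
    (mu^T *m P *m Q) *m S *m (Q *m P *m mu) by rewrite !mulmxA.
(* Splitting [S] as [S *m S] leaves one factor to absorb [Q] on each side. *)
rewrite muPQ QPmu -!scalemxAl muQS -{1}SS.
rewrite -!scalemxAl -!scalemxAr -!mulmxA [S *m (Q *m mu)]mulmxA SQmu.
rewrite -!scalemxAr !scalerA [S *m (S *m mu)]mulmxA SS; congr (_ *: _).
by field; rewrite ?a0 ?b0.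
Qed.

End BalancedAlgebra.

Section Families.
Variables (R : realType) (n : nat).

Lemma orthogonal_idempotentsM (J : finType) (E : J -> 'M[R]_n) j k :
  orthogonal_idempotents E -> E j *m E k = (j == k)%:R *: E j.
Proof.
move=> [_ _ EE E0]; have [<-|neq] := eqVneq; first by rewrite scale1r EE.
by rewrite scale0r E0.
Qed.

(** The sum of all [Q] absorbs [Q k], so balance may be multiplied by [Q k] on the right;
    orthogonality then kills the case of distinct indices. *)
Lemma structure_balancedM (I J : finType) (P : I -> 'M[R]_n) (Q : J -> 'M[R]_n)
    (lam : I -> J -> R) i j k :
    (forall j k, Q j *m Q k = (j == k)%:R *: Q j) ->
    structure_balanced P Q lam ->
  Q j *m P i *m Q k = ((j == k)%:R * lam i j) *: Q j.
Proof.
move=> QQ bal; have IQ : (\sum_j' Q j') *m Q k = Q k.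
  rewrite mulmx_suml (bigD1 k)//= big1 ?addr0 => [|j']; rewrite QQ.
    by rewrite eqxx scale1r.
  by move=> /negPf ->; rewrite scale0r.
by rewrite -{1}IQ mulmxA bal -scalemxAl QQ scalerA mulrC.
Qed.

Lemma structure_balanced_fix (I J : finType) (P : I -> 'M[R]_n)
    (Q : J -> 'M[R]_n) (lam : I -> J -> R) i j (mu : 'cV[R]_n) :
    structure_balanced P Q lam -> (\sum_j' Q j') *m mu = mu ->
  Q j *m P i *m mu = lam i j *: (Q j *m mu).
Proof. by move=> bal IQ; rewrite -{1}IQ mulmxA bal scalemxAl. Qed.

End Families.

(** * Transport of matrices along a map with orthogonal columns of equal norm *)

Definition lift_mx (R : realType) m n (X : 'M[R]_(m, n)) (r : R) (E : 'M[R]_n) :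
    'M[R]_m :=
  r^-1 *: (X *m E *m X^T).

Section Lift.
Variables (R : realType) (m n : nat) (X : 'M[R]_(m, n)) (r : R).
Hypotheses (r0 : r != 0) (XX : X^T *m X = r%:M).

Local Notation lift := (lift_mx X r).

(** Since X'X = r I, lifting is conjugation by the isometry X / sqrt r; this intertwining relation
    is what makes it multiplicative and injective. *)
Lemma lift_mulX E : lift E *m X = X *m E.
Proof.
by rewrite /lift_mx -scalemxAl -mulmxA XX mul_mx_scalar scalerA mulVf// scale1r.
Qed.

Lemma lift_mul E F : lift E *m lift F = lift (E *m F).
Proof.
by rewrite {2}/lift_mx -scalemxAr !mulmxA lift_mulX /lift_mx -!mulmxA.
Qed.

Lemma lift_tr E : E^T = E -> (lift E)^T = lift E.
Proof. by move=> sE; rewrite /lift_mx linearZ /= !trmx_mul trmxK sE mulmxA. Qed.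

Lemma lift_sum (I : finType) (E : I -> 'M[R]_n) :
  \sum_i lift (E i) = lift (\sum_i E i).
Proof. by rewrite /lift_mx mulmx_sumr mulmx_suml scaler_sumr. Qed.

(** This is where the factor r in front of eta comes from: the normalization of [lift_mx] has to be
    undone. *)
Lemma lift_lincomb (I : finType) (c : I -> R) (E : I -> 'M[R]_n) :
  X *m (\sum_i c i *: E i) *m X^T = r *: \sum_i c i *: lift (E i).
Proof.
rewrite mulmx_sumr mulmx_suml scaler_sumr; apply: eq_bigr => i _.
by rewrite -scalemxAr -scalemxAl /lift_mx !scalerA mulrAC divff// mul1r.
Qed.

Lemma lift_eq0 E : lift E = 0 -> E = 0.
Proof.
move=> /(congr1 (fun M => X^T *m (M *m X))).
rewrite lift_mulX mulmxA XX mul0mx mulmx0 mul_scalar_mx => /eqP.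
by rewrite scaler_eq0 (negPf r0) => /eqP.
Qed.

End Lift.

(** The columns are the indicators of the fibres of [f], which are pairwise disjoint. *)
Lemma incidence_gram (R : realType) (A B : finType) (f : A -> B) :
  (incidence R f)^T *m incidence R f =
    diag_mx (\row_j #|[pred a | f a == enum_val j]|%:R).
Proof.
apply/matrixP => i j; rewrite !mxE.
under eq_bigr do rewrite !mxE -natrM mulnb.
have [<-|neq] := eqVneq i j; last first.
  rewrite big1// => k _; case: eqP => //= ->; case: eqP => // /enum_val_inj ij.
  by rewrite ij eqxx in neq.
under eq_bigr do rewrite andbb.
rewrite (reindex_onto enum_rank enum_val) => [|k _]; last exact: enum_valK.
under eq_bigr do rewrite enum_rankK.
rewrite -natr_sum mulr1n -sum1_card [in RHS]big_mkcond; congr _%:R.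
apply: eq_big => a; first by rewrite enum_rankK eqxx.
by rewrite inE; case: eqP.
Qed.

(** * Moments of the linear model *)

Section Independence.
Context d (T : measurableType d) (R : realType) (Pr : probability T R).

(** Independence says that the joint law and the product of the marginal laws agree on rectangles,
    hence everywhere; Fubini then factors the integral of x y. *)
Lemma expectationM_independent (X Y : {RV Pr >-> R}) :
    (forall A B : set R, measurable A -> measurable B ->
      Pr (X @^-1` A `&` Y @^-1` B)%classic =
      (Pr (X @^-1` A)%classic * Pr (Y @^-1` B)%classic)%E) ->
    (X : T -> R) \in Lfun Pr 1 -> (Y : T -> R) \in Lfun Pr 1 ->
    ((X : T -> R) * (Y : T -> R)) \in Lfun Pr 1 ->
  'E_Pr[(X : T -> R) * (Y : T -> R)]%E = ('E_Pr[X] * 'E_Pr[Y])%E.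
Proof.
move=> indep X1 Y1 XY1.
have mXY : measurable_fun setT (fun t => (X t, Y t)).
  exact: measurable_fun_pair.
pose XY : {mfun T >-> (R * R)%type} :=
  HB.pack (fun t => (X t, Y t)) (isMeasurableFun.Build _ _ _ _ _ mXY).
pose m1 := distribution Pr X; pose m2 := distribution Pr Y.
pose g (p : R * R) := (p.1 * p.2)%:E.
have mg : @measurable_fun _ _ (R * R)%type (\bar R) setT g.
  by apply/measurable_EFinP; exact: measurable_funM.
have prodE A : measurable A -> (m1 \x m2)%E A = distribution Pr XY A.
  move=> mA; apply: product_measure_unique => // B C mB mC.
have ig : (distribution Pr XY).-integrable setT g.
  apply: integrable_pushforward => //.
  exact/Lfun1_integrable.
(* Fubini needs integrability for the product measure; it is carried over from the joint law, which
   is the same measure. *)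
have igp : (m1 \x m2)%E.-integrable setT g.
  move/integrableP: ig => [_ ig]; apply/integrableP; split=> //.
  rewrite (@eq_measure_integral _ _ _ _ (distribution Pr XY))// => A mA _.
  exact: prodE.
have intX (Z : {RV Pr >-> R}) : (Z : T -> R) \in Lfun Pr 1 ->
    (\int[distribution Pr Z]_x x%:E = 'E_Pr[Z])%E.
  move=> Z1; rewrite integral_distribution ?expectation_def//.
  exact/Lfun1_integrable.
have -> : ('E_Pr[(X : T -> R) * (Y : T -> R)] =
    \int[distribution Pr XY]_p g p)%E.
  rewrite integral_distribution//; first by rewrite unlock.
  exact/Lfun1_integrable.
rewrite -(@eq_measure_integral _ _ _ _ _ (m1 \x m2)%E); last first.
  by move=> A mA _; exact: prodE.
rewrite -integral12_prod_meas1// /fubini_F.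
under eq_integral => x _.
  rewrite (_ : (\int[_]_y _ = x%:E * 'E_Pr[Y])%E); last first.
    rewrite -(intX _ Y1) -integralZl//.
    by apply: integrable_pushforward => //; exact/Lfun1_integrable.
  over.
rewrite -(intX _ X1) /= -(fineK (expectation_fin_num Y1)) integralZr//.
by apply: integrable_pushforward => //; exact/Lfun1_integrable.
Qed.

Lemma Lfun2_sum (I : Type) (r : seq I) (F : I -> T -> R) :
  (forall i, F i \in Lfun Pr 2%:E) -> \sum_(i <- r) F i \in Lfun Pr 2%:E.
Proof. by move=> F2; rewrite rpred_sum// ?lee1n. Qed.

Lemma expectation_bigsum (I : finType) (F : I -> T -> R) :
    (forall i, F i \in Lfun Pr 1) ->
  'E_Pr[\sum_i F i]%E = (\sum_i 'E_Pr[F i])%E.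
Proof.
move=> F1; rewrite -(big_map F xpredT id) expectation_sum ?big_map//.
by move=> _ /mapP[i _ ->].
Qed.

Lemma covariance_suml (I : Type) (r : seq I) (c : I -> R) (F : I -> T -> R)
    (G : T -> R) :
    (forall i, F i \in Lfun Pr 2%:E) -> G \in Lfun Pr 2%:E ->
  covariance Pr (\sum_(i <- r) c i \o* F i) G =
    (\sum_(i <- r) (c i)%:E * covariance Pr (F i) G)%E.
Proof.
move=> F2 G2; have Pfin := fin_num_measure Pr _ measurableT.
have cF2 i : c i \o* F i \in Lfun Pr 2%:E by rewrite Lfun_scale// ler1n.
elim: r => [|i r IHr].
  by rewrite !big_nil (_ : 0 = cst 0) ?covariance_cst_l.
rewrite !big_cons covarianceDl//; last exact: Lfun2_sum.
rewrite IHr covarianceZl//.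
- exact: (Lfun_subset12 Pfin).
- exact: (Lfun_subset12 Pfin).
- exact: Lfun2_mul_Lfun1.
Qed.

(** The form is expanded into the terms A_ab U_a U_b, and E(U_a U_b) = Cov(U_a, U_b) + m_a m_b. *)
Lemma expectation_quadratic_form n (U : 'I_n -> T -> R) (V A : 'M[R]_n)
    (m : 'cV[R]_n) :
    (forall a, U a \in Lfun Pr 2%:E) ->
    (forall a, 'E_Pr[U a]%E = (m a 0)%:E) ->
    (forall a b, covariance Pr (U a) (U b) = (V a b)%:E) ->
  'E_Pr[fun t => ((\col_a U a t)^T *m A *m (\col_a U a t)) 0%R 0%R]%E =
    (\tr (A *m V) + (m^T *m A *m m) 0 0)%:E.
Proof.
move=> U2 EU covU; have Pfin := fin_num_measure Pr _ measurableT.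
have U1 a := Lfun_subset12 Pfin (U2 a).
have UU1 a b := Lfun2_mul_Lfun1 (U2 a) (U2 b).
pose F (p : 'I_n * 'I_n) := A p.1 p.2 \o* (U p.1 \* U p.2).
have quadE (x : 'cV[R]_n) : (x^T *m A *m x) 0 0 =
    \sum_(p : 'I_n * 'I_n) x p.1 0 * x p.2 0 * A p.1 p.2.
  rewrite mxE -(pair_bigA _ (fun a b => x a 0 * x b 0 * A a b)) exchange_big /=.
  apply: eq_bigr => b _; rewrite mxE big_distrl /=; apply: eq_bigr => a _.
  by rewrite mxE mulrAC.
have -> : (fun t => ((\col_a U a t)^T *m A *m (\col_a U a t)) 0 0) =
    \sum_p F p.
  apply/funext => t; rewrite quadE fct_sumE; apply: eq_bigr => p _.
  by rewrite !mxE.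
rewrite expectation_bigsum => [|p]; last by rewrite Lfun_scale.
(* The covariance is taken in swapped order, so that summing A_ab V_ba over b gives a diagonal entry
   of A V. *)
rewrite (eq_bigr (fun p => (A p.1 p.2 * V p.2 p.1 +
    m p.1 0 * m p.2 0 * A p.1 p.2)%:E)) => [|p _]; last first.
  rewrite expectationZl// -[U p.1 \* U p.2]/(U p.1 * U p.2).
  have := covarianceE (U1 p.1) (U1 p.2) (UU1 p.1 p.2).
  rewrite covarianceC covU !EU => /eqP.
  have EUU := expectation_fin_num (UU1 p.1 p.2).
  rewrite -(fineK EUU) -EFinM -EFinB eqe eq_sym subr_eq => /eqP ->.
  by rewrite -EFinM mulrDr; congr (_ + _)%:E; rewrite mulrC.
rewrite sumEFin big_split /= -quadE; congr (_ + _)%:E.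
rewrite -(pair_bigA _ (fun a b => A a b * V b a)) /mxtrace.
by apply: eq_bigr => a _; rewrite mxE.
Qed.

End Independence.

(** * Mean and covariance of Z + X W + mu *)

Section Model.
Context d (T : measurableType d) (R : realType) (Pr : probability T R).

(** Reduces independence of the vectors to independence of single coordinates. *)
Lemma g_sigma_preimage_coord n (Z : 'I_n -> {RV Pr >-> R}) i (B : set R) :
  measurable B ->
  g_sigma_preimage (fun i => Z i : T -> R) (Z i @^-1` B)%classic.
Proof.
move=> mB; apply: sub_sigma_algebra; rewrite (bigD1 i)//=; left.
by exists B => //; rewrite setTI.
Qed.

Variables (m n : nat) (Z : 'I_m -> {RV Pr >-> R}) (W : 'I_n -> {RV Pr >-> R}).
Variables (VZ : 'M[R]_m) (VW : 'M[R]_n).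
Hypotheses (ZW_indep : independent_vectors Z W).
Hypotheses (Z_cov : mean0_cov Z VZ) (W_cov : mean0_cov W VW).

Let Z2 a : (Z a : T -> R) \in Lfun Pr 2%:E. Proof. by have [] := Z_cov. Qed.
Let W2 u : (W u : T -> R) \in Lfun Pr 2%:E. Proof. by have [] := W_cov. Qed.
Let sub12 := Lfun_subset12 (fin_num_measure Pr _ measurableT).

Lemma covariance_independent a u : covariance Pr (Z a) (W u) = 0%E.
Proof.
have [_ EZ _] := Z_cov; have [_ EW _] := W_cov.
have Z1 := sub12 (Z2 a); have W1 := sub12 (W2 u).
have ZW1 := Lfun2_mul_Lfun1 (Z2 a) (W2 u).
rewrite covarianceE// (@expectationM_independent _ _ _ _ (Z a) (W u))//.
  by rewrite EZ EW mul0e sube0.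
by move=> A B mA mB; apply: ZW_indep; exact: g_sigma_preimage_coord.
Qed.

Variables (X : 'M[R]_(m, n)) (mu : 'cV[R]_m).

Let XW a : T -> R := \sum_u (X a u \o* (W u : T -> R)).
Let U a : T -> R := ((Z a : T -> R) \+ XW a) \+ cst (mu a 0).

Let XW2 a : XW a \in Lfun Pr 2%:E.
Proof. by apply: Lfun2_sum => u; rewrite Lfun_scale// ler1n. Qed.

Let ZXW2 a : ((Z a : T -> R) \+ XW a) \in Lfun Pr 2%:E.
Proof. by rewrite rpredD// lee1n. Qed.

Let cst2 a : cst (mu a 0) \in Lfun Pr 2%:E.
Proof. exact: Lfun_cst. Qed.

Let U2 a : U a \in Lfun Pr 2%:E.
Proof. by rewrite rpredD// lee1n. Qed.

Let EXW a : 'E_Pr[XW a]%E = 0%E.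
Proof.
have [_ EW _] := W_cov.
rewrite expectation_bigsum => [|u]; last by rewrite Lfun_scale// sub12.
by rewrite big1// => u _; rewrite expectationZl ?sub12// EW mule0.
Qed.

Let EU a : 'E_Pr[U a]%E = (mu a 0)%:E.
Proof.
have [_ EZ _] := Z_cov.
by rewrite !expectationD ?sub12// EZ EXW expectation_cst !add0e.
Qed.

Let covZXW a b : covariance Pr (XW a) (Z b) = 0%E.
Proof.
rewrite covariance_suml// big1// => u _.
by rewrite covarianceC covariance_independent mule0.
Qed.

Let covXW a b : covariance Pr (XW a) (XW b) = ((X *m VW *m X^T) a b)%:E.
Proof.
have [_ _ cW] := W_cov.
rewrite covariance_suml// -mulmxA mxE -sumEFin; apply: eq_bigr => u _.
rewrite covarianceC covariance_suml// EFinM; congr (_ * _)%E.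
rewrite mxE -sumEFin; apply: eq_bigr => v _.
by rewrite covarianceC cW -EFinM !mxE mulrC.
Qed.

Let covU a b :
  covariance Pr (U a) (U b) = ((VZ + X *m VW *m X^T) a b)%:E.
Proof.
have [_ _ cZ] := Z_cov.
rewrite covarianceDl// covariance_cst_l adde0 covarianceDr//.
rewrite covariance_cst_r adde0 covarianceDl// !covarianceDr//.
rewrite cZ covXW covZXW (covarianceC _ _ (XW b)) covZXW adde0 add0e.
by rewrite [in RHS]mxE EFinD.
Qed.

Lemma expected_mean_square_linear_model (Y : T -> 'cV[R]_m) (A : 'M[R]_m) :
    (forall t, Y t = (\col_w Z w t) + X *m (\col_u W u t) + mu) ->
  expected_mean_square Pr Y A =
    ((\tr (A *m (VZ + X *m VW *m X^T)) + (mu^T *m A *m mu) 0 0)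
      / (\rank A)%:R)%:E.
Proof.
(* The division by the rank is moved into the matrix of the form. *)
move=> def_Y; pose B := (\rank A)%:R^-1 *: A.
have YE t : Y t = \col_a U a t.
  apply/colP => a; rewrite def_Y !mxE /U /=; congr (_ + _ + _).
  by rewrite /XW fct_sumE; apply: eq_bigr => u _; rewrite mxE mulrC.
rewrite /expected_mean_square.
have -> : mean_square Y A =
    fun t => ((\col_a U a t)^T *m B *m (\col_a U a t)) 0 0.
  apply/funext => t; rewrite /mean_square YE /B -scalemxAr -scalemxAl.
  by rewrite [RHS]mxE mulrC.
rewrite (expectation_quadratic_form B U2 EU covU) /B -scalemxAl mxtraceZ.
by rewrite -scalemxAr -scalemxAl [X in _ + X]mxE -mulrDr mulrC.
Qed.

End Model.

(** * Expected mean squares *)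

Lemma incidence_gram_equireplicate (R : realType) (A B : finType) (f : A -> B)
    (r : nat) : equireplicate f r ->
  (incidence R f)^T *m incidence R f = r%:R%:M.
Proof.
move=> fr; rewrite incidence_gram -diag_const_mx; congr diag_mx.
by apply/rowP => j; rewrite !mxE fr.
Qed.

Lemma incidence_gram_unit (R : realType) (A B : finType) (f : A -> B) :
    (forall b, exists a, f a = b) ->
  (incidence R f)^T *m incidence R f \in unitmx.
Proof.
move=> f_surj; rewrite incidence_gram unitmxE det_diag unitfE.
apply/prodf_neq0 => j _; rewrite mxE pnatr_eq0 -lt0n.
have [a fa] := f_surj (enum_val j).
by apply/card_gt0P; exists a; rewrite inE fa.
Qed.

Theorem mainTheorem1 (R : realType)
  (* the two randomizations *)
  (Omega Upsilon Gamma : finType)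
  (f : Omega -> Upsilon) (h : Upsilon -> Gamma) (r : nat)
  (f_surj : forall u, exists w, f w = u)
  (h_surj : forall g, exists u, h u = g)
  (f_equi : equireplicate f r)
  (Xf : 'M[R]_(#|Omega|, #|Upsilon|)) (def_Xf : Xf = incidence R f)
  (Xh : 'M[R]_(#|Upsilon|, #|Gamma|)) (def_Xh : Xh = incidence R h)
  (Dh : 'M[R]_#|Gamma|) (def_Dh : Dh = Xh^T *m Xh)
  (* the set P of stratum projectors on Omega *)
  (G1 : {group {perm Omega}}) (G1_strat : stratifiable R G1)
  (I : finType) (P : I -> 'M[R]_#|Omega|) (P_strata : stratum_projectors G1 P)
  (* the set Q, from (a refinement of) the stratum projectors on Upsilon *)
  (G2 : {group {perm Upsilon}}) (G2_strat : stratifiable R G2)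
  (K : finType) (S : K -> 'M[R]_#|Upsilon|) (S_strata : stratum_projectors G2 S)
  (J : finType) (s : J -> K) (QU : J -> 'M[R]_#|Upsilon|)
  (QU_ref : refinement S s QU)
  (Q : J -> 'M[R]_#|Omega|)
  (def_Q : forall j, Q j = r%:R^-1 *: (Xf *m QU j *m Xf^T))
  (* the set R *)
  (L : finType) (RU : L -> 'M[R]_#|Upsilon|)
  (RU_idem : orthogonal_idempotents RU)
  (RU_sum : \sum_l RU l = Xh *m invmx Dh *m Xh^T)
  (RO : L -> 'M[R]_#|Omega|)
  (def_RO : forall l, RO l = r%:R^-1 *: (Xf *m RU l *m Xf^T))
  (* structure balance *)
  (lamPQ : I -> J -> R) (PQ_bal : structure_balanced P Q lamPQ)
  (lamQR : J -> L -> R) (QR_bal : structure_balanced Q RO lamQR)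
  (* the model *)
  (xi : I -> R) (xi_ge0 : forall i, 0 <= xi i)
  (eta : J -> R) (eta_ge0 : forall j, 0 <= eta j)
  (eta_strata : forall j j', s j = s j' -> eta j = eta j')
  (d : measure_display) (T : measurableType d) (Pr : probability T R)
  (Z : 'I_#|Omega| -> {RV Pr >-> R}) (W : 'I_#|Upsilon| -> {RV Pr >-> R})
  (ZW_indep : independent_vectors Z W)
  (Z_cov : mean0_cov Z (\sum_i xi i *: P i))
  (W_cov : mean0_cov W (\sum_j eta j *: QU j))
  (tau : 'cV[R]_#|Gamma|)
  (Y : T -> 'cV[R]_#|Omega|)
  (def_Y : forall t,
     Y t = (\col_w Z w t) + Xf *m (\col_u W u t) + Xf *m Xh *m tau)
  (i : I) (j : J) (l : L) (lam_neq0 : lamPQ i j * lamQR j l != 0) :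
  expected_mean_square Pr Y
    (derived_idempotent (lamPQ i j) (lamQR j l) (P i) (Q j) (RO l))
  = (xi i + r%:R * lamPQ i j * eta j +
     lamPQ i j * lamQR j l *
       (tau^T *m Xh^T *m Xf^T *m RO l *m Xf *m Xh *m tau) 0 0
       / (\rank (RO l))%:R)%:E.
Proof.
have [a0 b0] : lamPQ i j != 0 /\ lamQR j l != 0.
  by move: lam_neq0; rewrite mulf_eq0 negb_or => /andP[].
(* If r were 0, surjectivity of [f] would leave [Upsilon] empty, and [RU l] would be a nonzero
   matrix of size 0. *)
have r0 : r%:R != 0 :> R.
  have [/(_ l)/eqP RUl0 _ _ _] := RU_idem.
  rewrite pnatr_eq0 -lt0n; apply: contra_notT RUl0.
  rewrite -eqn0Ngt => /eqP r_eq0.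
  apply/matrixP => u; have [w fw] := f_surj (enum_val u).
  have /card0_eq/(_ w) := etrans (f_equi (enum_val u)) r_eq0.
  by rewrite inE fw eqxx.
have XX : Xf^T *m Xf = r%:R%:M.
  by rewrite def_Xf (incidence_gram_equireplicate _ f_equi).
have uDh : Dh \in unitmx by rewrite def_Dh def_Xh incidence_gram_unit.
have [QU_idem S_sum] := QU_ref; have [_ sQU _ _] := QU_idem.
have [RUn0 sRU _ _] := RU_idem.
(* The pieces are regrouped by [s] into strata, which sum to the identity. *)
have QUsum : \sum_j QU j = 1%:M.
  rewrite (partition_big s xpredT)//=.
  rewrite -(sum_stratum_projectors S_strata G2_strat).
  by apply: eq_bigr => k _; rewrite S_sum.
have QE j' : Q j' = lift_mx Xf r%:R (QU j') by exact: def_Q.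
have RE l' : RO l' = lift_mx Xf r%:R (RU l') by exact: def_RO.
pose mu := Xf *m Xh *m tau.
have QQ j1 j2 : Q j1 *m Q j2 = (j1 == j2)%:R *: Q j1.
  rewrite !QE (lift_mul r0 XX) orthogonal_idempotentsM//.
  by rewrite /lift_mx -scalemxAr -scalemxAl scalerA mulrC -scalerA.
have RR l1 l2 : RO l1 *m RO l2 = (l1 == l2)%:R *: RO l1.
  rewrite !RE (lift_mul r0 XX) orthogonal_idempotentsM//.
  by rewrite /lift_mx -scalemxAr -scalemxAl scalerA mulrC -scalerA.
have IQmu : (\sum_j Q j) *m mu = mu.
  under eq_bigr do rewrite QE.
  by rewrite lift_sum QUsum /mu !mulmxA (lift_mulX r0 XX) mulmx1.
(* The [RU l] sum to the projector onto the column space of [Xh]: its factor [invmx Dh] cancels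
   against [Xh^T *m Xh]. *)
have IRmu : (\sum_l RO l) *m mu = mu.
  under eq_bigr do rewrite RE.
  rewrite lift_sum RU_sum /mu !mulmxA (lift_mulX r0 XX) -!mulmxA.
  by rewrite [Xh^T *m _]mulmxA -def_Dh mulKmx.
have PP i1 i2 := stratum_projectors_idem P_strata i1 i2.
have P1 : P i *m P i = P i by rewrite PP eqxx scale1r.
have R1 : RO l *m RO l = RO l by rewrite RR eqxx scale1r.
have QPQ' j' : Q j *m P i *m Q j' = ((j == j')%:R * lamPQ i j) *: Q j.
  exact: structure_balancedM.
have QPQ : Q j *m P i *m Q j = lamPQ i j *: Q j by rewrite QPQ' eqxx mul1r.
have RQR : RO l *m Q j *m RO l = lamQR j l *: RO l.
  by rewrite (structure_balancedM _ _ _ RR QR_bal) eqxx mul1r.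
rewrite (expected_mean_square_linear_model ZW_indep Z_cov W_cov _ def_Y) -/mu.
set A := derived_idempotent _ _ _ _ _.
have trR : \tr (RO l) = (\rank (RO l))%:R by exact: mxtrace_idem.
have rankA : (\rank A)%:R = \tr (RO l) :> R.
  rewrite -(mxtrace_derived P1 QPQ R1 RQR a0 b0) mxtrace_idem//.
  exact: derived_idem.
have rankR : (\rank (RO l))%:R != 0 :> R.
  rewrite pnatr_eq0 mxrank_eq0; apply: contra (RUn0 l) => /eqP.
  by rewrite RE => /(lift_eq0 r0 XX) ->.
have AP : A *m P i = A by exact: derived_mulP.
(* As A = A P_i, every other stratum of the first family is annihilated. *)
have trAP : \tr (A *m \sum_i xi i *: P i) = xi i * \tr A.
  rewrite mulmx_sumr (bigD1 i)//= big1 ?addr0 => [|i' i'i].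
    by rewrite -scalemxAr mxtraceZ AP.
  rewrite -scalemxAr -AP -mulmxA PP eq_sym (negPf i'i).
  by rewrite scale0r mulmx0 scaler0.
(* For another index, [A *m Q j'] contains Q_j P_i Q_j', which is zero by balance. *)
have trAQ : \tr (A *m (\sum_j eta j *: Q j)) = eta j * (lamPQ i j * \tr (RO l)).
  rewrite mulmx_sumr (bigD1 j)//= big1 ?addr0 => [|j' j'j].
    by rewrite -scalemxAr mxtraceZ (mxtrace_derivedQ QPQ R1 RQR a0 b0).
  rewrite /A /derived_idempotent -scalemxAr -scalemxAl.
  have -> : P i *m Q j *m RO l *m Q j *m P i *m Q j' =
      P i *m Q j *m RO l *m (Q j *m P i *m Q j') by rewrite !mulmxA.
  rewrite QPQ' eq_sym (negPf j'j) mul0r scale0r mulmx0.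
  by rewrite !scaler0.
have sP : (P i)^T = P i := stratum_projectors_tr P_strata i.
have sQ : (Q j)^T = Q j by rewrite QE lift_tr.
have sR : (RO l)^T = RO l by rewrite RE lift_tr.
rewrite (derived_quadratic_form R1 a0 b0 sP sQ sR); last 2 first.
- exact: structure_balanced_fix PQ_bal IQmu.
- exact: structure_balanced_fix QR_bal IRmu.
rewrite (lift_lincomb Xf r0); under [X in _ *: X]eq_bigr do rewrite -QE.
rewrite mulmxDr mxtraceD trAP -scalemxAr [\tr (r%:R *: _)]mxtraceZ trAQ.
have trA : \tr A = \tr (RO l) by rewrite -rankA mxtrace_idem// derived_idem.
have muR : mu^T *m RO l *m mu =
    tau^T *m Xh^T *m Xf^T *m RO l *m Xf *m Xh *m tau.
  by rewrite /mu !trmx_mul !mulmxA.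
rewrite [X in _ + X]mxE muR rankA trA trR; congr EFin.
by field.
Qed.
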